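(* Let $X$ be a finite-dimensional Banach space and let $F:[0,1]\to 2^{X}\setminus\{\varnothing\}$ be a bounded multifunction. Then $I(F)$ is convex, i.e. for all $A,B\in I(F)$ and all $\lambda\in[0,1]$ one has $\lambda A+(1-\lambda)B\in I(F)$.
   Context: For subsets $A,B$ of a Banach space $X$ and $\lambda\in\mathbb{R}$: $A+B=\{a+b: a\in A, b\in B\}$, $\lambda A=\{\lambda a: a\in A\}$. A tagged partition $(\Gamma,T)$ of $[0,1]$ consists of a partition $\Gamma=\{\Delta_i\}_{i=1}^n$ of $[0,1]$ into (non-overlapping closed) segments $\Delta_i=[a_i,b_i]$ and tags $T=\{\xi_i\}_{i=1}^n$, $\xi_i\in\Delta_i$. Write $|\Delta_i|=b_i-a_i$ and $d(\Gamma)=\max_i|\Delta_i|$. A multifunction is a map $F:[0,1]\to 2^X\setminus\{\varnothing\}$. It is bounded if $M(F)=\sup\{\|a\|: a\in F(t), t\in[0,1]\}<\infty$. Its Riemann sums are $S(F,\Gamma,T)=\sum_{i=1}^n|\Delta_i|F(\xi_i)$ (Minkowski sum). The Hausdorff distance between non-empty sets is $d_H(A,B)=\max\{\sup_{a\in A}d(a,B),\sup_{b\in B}d(b,A)\}$. For bounded $F$, $I(F)$ is the collection of all non-empty closed subsets $A\subset X$ for which there is a sequence of tagged partitions $(\Gamma_k,T_k)$ with $d(\Gamma_k)\to0$ and $d_H(S(F,\Gamma_k,T_k),A)\to0$ as $k\to\infty$. *)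

(* Defs.v *)
From HB Require Import structures.
From mathcomp Require Import all_boot all_order all_algebra.
From mathcomp Require Import all_classical all_reals all_analysis.
Set Implicit Arguments.
Unset Strict Implicit.
Unset Printing Implicit Defensive.
Import Order.TTheory GRing.Theory Num.Theory.
Import numFieldNormedType.Exports.
Local Open Scope classical_set_scope.
Local Open Scope ring_scope.

(* [Vector.axiom n X] is a type of linear bijections between X and 'rV[R]_n,
   hence [inhabited]. *)
Definition finite_dimensional (R : realType) (X : lmodType R) : Prop :=
  exists n : nat, inhabited (Vector.axiom n X).

Definition set_add (V : zmodType) (A B : set V) : set V :=
  [set a + b | a in A & b in B].

Definition set_scale (R : pzRingType) (V : lmodType R) (l : R) (A : set V) :
    set V :=
  [set l *: a | a in A].

(* The partition with segments [x_i, x_(i+1)], 0 = x_0 < x_1 < ... < x_n = 1,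
   is stored as in [itv_partition]: [division] is the sequence x_1, ..., x_n,
   without the initial point 0. *)
Record tagged_partition (R : realType) := TaggedPartition {
  division : seq R ;
  divisionP : itv_partition 0 1 division ;
  tag : 'I_(size division) -> R ;
  tagP : forall i : 'I_(size division),
    tag i \in `[nth 0 (0 :: division) i, nth 0 (0 :: division) i.+1] }.

Definition seglen (R : realType) (P : tagged_partition R)
    (i : 'I_(size (division P))) : R :=
  nth 0 (0 :: division P) i.+1 - nth 0 (0 :: division P) i.

Definition mesh (R : realType) (P : tagged_partition R) : R :=
  \big[Num.max/0]_(i < size (division P)) seglen i.

(* Multifunctions on [0, 1] are represented by total functions R -> set X;
   only their values on [0, 1] are ever used. *)
Definition multifunction (R : realType) (X : Type) (F : R -> set X) : Prop :=
  forall t, t \in `[0, 1] -> F t !=set0.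

Definition multifunction_sup (R : realType) (X : normedModType R)
    (F : R -> set X) : \bar R :=
  ereal_sup [set `|a|%:E | a in \bigcup_(t in `[0, 1]) F t].

Definition bounded_multifunction (R : realType) (X : normedModType R)
    (F : R -> set X) : Prop :=
  (multifunction_sup F < +oo)%E.

Definition riemann_sum (R : realType) (X : lmodType R) (F : R -> set X)
    (P : tagged_partition R) : set X :=
  \big[@set_add X/[set 0]]_(i < size (division P))
    set_scale (seglen i) (F (tag i)).

(* The distance used by [edist_inf] is the one induced by the norm. *)
Lemma edist_norm (R : realType) (X : normedModType R) (x y : X) :
  edist (x, y) = `|x - y|%:E.
Proof.
apply/eqP; rewrite eq_le; apply/andP; split; last first.
  apply: le_ereal_inf_tmp => _ [r [r0 /=]] + <-.
  by rewrite -ball_normE /= lee_fin => /ltW.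
apply/lee_addgt0Pr => e e0; apply: ereal_inf_lbound.
exists (`|x - y| + e); last by rewrite EFinD.
split; first by rewrite ltr_wpDl.
by rewrite -ball_normE /= ltrDl.
Qed.

Definition hausdorff_dist (R : realType) (X : normedModType R)
    (A B : set X) : \bar R :=
  maxe (ereal_sup [set edist_inf B a | a in A])
       (ereal_sup [set edist_inf A b | b in B]).

Definition riemann_limits (R : realType) (X : normedModType R)
    (F : R -> set X) : set (set X) :=
  [set A | [/\ A !=set0, closed A &
    exists P : nat -> tagged_partition R,
      mesh (P k) @[k --> \oo] --> (0 : R) /\
      hausdorff_dist (riemann_sum F (P k)) A @[k --> \oo] --> 0%E]].

(* Main.v *)
Require Import Defs.
From HB Require Import structures.
From mathcomp Require Import all_boot all_order all_algebra.
From mathcomp Require Import all_classical all_reals all_analysis.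
From mathcomp Require Import ring lra.
Set Implicit Arguments.
Unset Strict Implicit.
Unset Printing Implicit Defensive.
Import Order.TTheory GRing.Theory Num.Theory.
Import numFieldNormedType.Exports.
Local Open Scope classical_set_scope.
Local Open Scope ring_scope.

(* Fix a finite net [p] of a ball containing all values of [F], and label [t]
   by the set of net points close to [F t]. Up to a small error, a Riemann sum
   of [F] is then the Minkowski sum of the finite sets of net points, and each
   of its points is a combination of the [p i] whose weights split, for every
   label [j], the total length of the segments labelled [j] among the net
   points in [j]. Conversely, every such splitting is almost realised if the
   mesh is small, so that a Riemann sum is determined, up to a small error, by
   its vector of label masses. It remains to find a tagged partition whose
   label masses are close to the convex combination of those of two given fine
   partitions: cut [0, 1] into blocks and copy on each block one of the two
   partitions.
   Both approximations (splitting a mass, choosing a partition on each block)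
   are derandomised second moment arguments: at each step some choice increases
   the squared Euclidean norm of the accumulated error by at most
   the variance of the choice. *)

(** * Derandomised second moment choices *)

Section Balancing.
Context {R : realType}.
Implicit Types (T I : finType).

Definition sqnorm {T} (w : {ffun T -> R}) : R := \sum_t w t ^+ 2.

Lemma sqnorm0 {T} : sqnorm (0 : {ffun T -> R}) = 0.
Proof. by rewrite /sqnorm big1// => t _; rewrite ffunE expr0n. Qed.

Lemma sqnorm_coord {T} (w : {ffun T -> R}) (e : R) :
  0 <= e -> sqnorm w <= e ^+ 2 -> forall t, `|w t| <= e.
Proof.
move=> e0 we t; rewrite -ler_sqr ?nnegrE// real_normK ?num_real//.
apply: le_trans we; rewrite /sqnorm (bigD1 t)//= lerDl.
by apply: sumr_ge0 => i _; exact: sqr_ge0.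
Qed.

Lemma sqnorm_le {T} (w : {ffun T -> R}) (e : R) :
  (forall t, `|w t| <= e) -> sqnorm w <= e ^+ 2 *+ #|T|.
Proof.
move=> we; rewrite -sum1_card -sumrMnr; apply: ler_sum => t _.
rewrite mulr1n -(real_normK (num_real (w t))) ler_sqr ?nnegrE//.
exact: le_trans (we t).
Qed.

(** If [c i] were positive wherever [q i] is, all terms would vanish, hence all weights. Positive
    weight matters later: it keeps the chosen net point inside the label. *)
Lemma wavg_nonpos {I} (q c : I -> R) :
  (forall i, 0 <= q i) -> \sum_i q i = 1 -> \sum_i q i * c i <= 0 ->
  exists2 i, 0 < q i & c i <= 0.
Proof.
move=> q0 q1 qc; apply: contrapT => /forall2NP h.
have pos i : 0 <= q i * c i.
  have := q0 i; rewrite le_eqVlt => /orP[/eqP <-|qi]; first by rewrite mul0r.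
  case: (h i) => // /negP; rewrite -ltNge => ci.
  by rewrite mulr_ge0 ?ltW.
have s0 : \sum_i q i * c i = 0.
  by apply/eqP; rewrite eq_le qc/= sumr_ge0.
have z : forall i, q i = 0.
  move=> i; move/eqP: s0; rewrite psumr_eq0// => /allP/(_ i).
  rewrite mem_index_enum => /(_ isT)/=; rewrite mulf_eq0 => /orP[/eqP//|/eqP ci0].
  have := q0 i; rewrite le_eqVlt => /orP[/eqP <-//|qi].
  by case: (h i) => // /negP; rewrite ci0 lexx.
by move/eqP: q1; rewrite big1// eq_sym oner_eq0.
Qed.

(* The average over [i] of the squared norm of [w + (v i - g)] is
   [sqnorm w] plus the variance, the cross terms averaging to zero. *)
Lemma balance {T I} (q : I -> R) (v : I -> {ffun T -> R}) (g w : {ffun T -> R})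
    (D : R) :
  (forall i, 0 <= q i) -> \sum_i q i = 1 -> g = \sum_i q i *: v i ->
  (forall i, 0 < q i -> sqnorm (v i - g) <= D) ->
  exists2 i, 0 < q i & sqnorm (w + (v i - g)) <= sqnorm w + D.
Proof.
move=> q0 q1 gE vD.
have [|i qi ci] := @wavg_nonpos I q (fun i => \sum_t w t * (v i - g) t) q0 q1.
  under eq_bigr do rewrite mulr_sumr.
  rewrite exchange_big/= big1// => t _.
  transitivity (w t * (\sum_i q i * v i t - (\sum_i q i) * g t)).
    rewrite mulr_suml -sumrB mulr_sumr; apply: eq_bigr => i _.
    by rewrite !ffunE; ring.
  rewrite q1 gE sum_ffunE mul1r.
  under [X in _ - X]eq_bigr do rewrite ffunE.
  by rewrite subrr mulr0.
exists i => //; apply: (@le_trans _ _ (sqnorm w + sqnorm (v i - g))); last first.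
  by rewrite lerD2l vD.
have -> : sqnorm (w + (v i - g)) =
    sqnorm w + sqnorm (v i - g) + 2 * \sum_t w t * (v i - g) t.
  rewrite /sqnorm mulr_sumr -!big_split/=; apply: eq_bigr => t _.
  by rewrite !ffunE; ring.
by rewrite gerDl pmulr_rle0.
Qed.

End Balancing.

(** * Tagged partitions as lists, and mixing two of them block by block *)

Section Chains.
Context {R : realType}.

(* Each pair of the list consists of the length and the tag of a segment. *)
Fixpoint tagged_chain (a b : R) (s : seq (R * R)) : Prop :=
  if s is u :: s' then
    [/\ 0 < u.1, a <= u.2 <= a + u.1 & tagged_chain (a + u.1) b s']
  else a = b.

Definition finer (d : R) (s : seq (R * R)) := all (fun u => u.1 <= d) s.

Definition chain_sum {V : lmodType R} (f : R -> V) (s : seq (R * R)) : V :=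
  \sum_(u <- s) u.1 *: f u.2.

Definition minkowski_sum {V : lmodType R} (F : R -> set V) (s : seq (R * R)) :
    set V :=
  \big[@set_add V/[set 0]]_(u <- s) set_scale u.1 (F u.2).

Lemma tagged_chain_le a b s : tagged_chain a b s -> a <= b.
Proof.
elim: s a => [a ->//|u s ih a /= [u0 _ /ih]].
by apply: le_trans; rewrite lerDl ltW.
Qed.

Lemma tagged_chain_cat a b c s1 s2 :
  tagged_chain a b s1 -> tagged_chain b c s2 -> tagged_chain a c (s1 ++ s2).
Proof. by elim: s1 a => [a ->//|u s1 ih a /= [? ? h] ?]; split=> //; exact: ih. Qed.

Lemma chain_sum_cat {V : lmodType R} (f : R -> V) s1 s2 :
  chain_sum f (s1 ++ s2) = chain_sum f s1 + chain_sum f s2.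
Proof. by rewrite /chain_sum big_cat. Qed.

Lemma chain_sum_cons {V : lmodType R} (f : R -> V) u s :
  chain_sum f (u :: s) = u.1 *: f u.2 + chain_sum f s.
Proof. by rewrite /chain_sum big_cons. Qed.

Lemma chain_sum_nil {V : lmodType R} (f : R -> V) : chain_sum f [::] = 0.
Proof. by rewrite /chain_sum big_nil. Qed.

Lemma minkowski_sum_nil {V : lmodType R} (F : R -> set V) (v : V) :
  minkowski_sum F [::] v <-> v = 0.
Proof. by rewrite /minkowski_sum big_nil. Qed.

Lemma minkowski_sum_cons {V : lmodType R} (F : R -> set V) u s (v : V) :
  minkowski_sum F (u :: s) v <->
  exists x y, [/\ F u.2 x, minkowski_sum F s y & v = u.1 *: x + y].
Proof.
rewrite /minkowski_sum big_cons; split.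
  by move=> [_ [x Fx <-] [y Fy <-]]; exists x, y.
by move=> [x [y [Fx Fy ->]]]; exists (u.1 *: x); [exists x|exists y].
Qed.

Section Coordinates.
Context {T : finType} (f : R -> {ffun T -> R}).
Hypothesis f01 : forall t j, 0 <= f t j <= 1.

Lemma chain_sum_coord a b s j : tagged_chain a b s ->
  0 <= chain_sum f s j <= b - a.
Proof.
elim: s a => [a ->|u s ih a /= [u0 _ /ih/andP[h1 h2]]].
  by rewrite chain_sum_nil ffunE subrr lexx.
rewrite chain_sum_cons 2!ffunE /GRing.scale/=.
have /andP[f0 f1] := f01 u.2 j.
have p0 : 0 <= u.1 * f u.2 j by rewrite mulr_ge0// ltW.
have p1 : u.1 * f u.2 j <= u.1 by rewrite ler_piMr// ltW.
by apply/andP; split; lra.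
Qed.

(** A segment straddling [c] is cut in two: the piece containing the tag keeps it, the other is
    retagged at [c]. Only the latter changes the sum, in each coordinate by at most its length,
    since [f] takes values between 0 and 1. *)
Lemma chain_split (a b c d : R) s : tagged_chain a b s -> finer d s ->
  a <= c <= b -> 0 <= d ->
  exists s1 s2, [/\ tagged_chain a c s1, tagged_chain c b s2, finer d s1,
    finer d s2 &
    forall j, `|chain_sum f s j - chain_sum f s1 j - chain_sum f s2 j| <= d].
Proof.
elim: s a => [a -> _ + d0|u s ih a [/= u0 /andP[au ua] us] /andP[ud sd]].
  rewrite -eq_le => /eqP ->.
  by exists [::], [::]; split=> // j; rewrite chain_sum_nil !ffunE !subr0 normr0.
move=> /andP[ac cb] d0; have [ca|{}ac] := leP c a.
  have <- : a = c by apply/eqP; rewrite eq_le ac ca.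
  exists [::], (u :: s); split=> //=; first by rewrite au.
    by rewrite ud.
  by move=> j; rewrite chain_sum_nil ffunE subr0 subrr normr0.
have [uc|cu] := leP (a + u.1) c.
  have [||s1 [s2 [h1 h2 h3 h4 h5]]] := ih _ us sd; rewrite ?uc//.
  exists (u :: s1), s2; split=> //=; rewrite ?au ?ud//.
  move=> j; rewrite !chain_sum_cons ffunE [X in _ - X - _]ffunE.
  by rewrite opprD addrACA subrr add0r.
have key (x y : R) j : 0 <= x <= d -> y \in `[0, 1] ->
    `|x * f u.2 j - x * y| <= d.
  move=> /andP[x0 xd]; rewrite in_itv/= => /andP[y0 y1].
  have /andP[f0 f1] := f01 u.2 j.
  rewrite -mulrBr normrM (ger0_norm x0) (le_trans _ xd)// ler_piMr//.
  by rewrite ler_norml; apply/andP; split; lra.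
have E : c + (a + u.1 - c) = a + u.1 by rewrite addrC subrK.
have [uc|{}cu'] := leP u.2 c.
  exists [:: (c - a, u.2)], ((a + u.1 - c, c) :: s); split=> /=.
  - by rewrite subr_gt0 subrKC au uc.
  - by rewrite subr_gt0 cu E lexx ltW.
  - by rewrite andbT; lra.
  - by rewrite sd andbT; lra.
  move=> j; rewrite !chain_sum_cons chain_sum_nil !ffunE/=.
  rewrite (_ : _ - _ - _ = (a + u.1 - c) * f u.2 j - (a + u.1 - c) * f c j).
    by apply: key; [apply/andP; split; lra | rewrite in_itv/= f01].
  by rewrite /GRing.scale/=; ring.
exists [:: (c - a, c)], ((a + u.1 - c, u.2) :: s); split=> /=.
- by rewrite subr_gt0 subrKC lexx ltW.
- by rewrite subr_gt0 cu E ua ltW.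
- by rewrite andbT; lra.
- by rewrite sd andbT; lra.
move=> j; rewrite !chain_sum_cons chain_sum_nil !ffunE/=.
rewrite (_ : _ - _ - _ = (c - a) * f u.2 j - (c - a) * f c j).
  by apply: key; [apply/andP; split; lra | rewrite in_itv/= f01].
by rewrite /GRing.scale/=; ring.
Qed.

(* Both chains are cut into [n] blocks of length [h]; on each block one of the
   two is kept, so as to control the Euclidean norm of the accumulated error.
   [e] collects the errors caused by the cuts. *)
Lemma chain_mix (l d h : R) n a b P Q (w : {ffun T -> R}) :
  0 <= l <= 1 -> 0 <= d -> 0 <= h -> b = a + h *+ n ->
  tagged_chain a b P -> tagged_chain a b Q -> finer d P -> finer d Q ->
  exists s (e : {ffun T -> R}), [/\ tagged_chain a b s, finer d s,
    forall j, `|e j| <= d *+ n &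
    sqnorm (w + (chain_sum f s - (l *: chain_sum f P + (1 - l) *: chain_sum f Q))
            + e) <= sqnorm w + h ^+ 2 *+ #|T| *+ n].
Proof.
move=> /andP[l0 l1] d0 h0.
elim: n a P Q w => [|n ih] a P Q w.
  rewrite mulr0n addr0 => ->.
  have nilE s : tagged_chain a a s -> s = [::].
    case: s => // u s /= [u0 _ /tagged_chain_le]; rewrite gerDl.
    by rewrite leNgt u0.
  move=> /nilE -> /nilE -> _ _; exists [::], 0; split=> //.
    by move=> j; rewrite ffunE normr0 mulr0n.
  by rewrite chain_sum_nil !(scaler0, addr0, subr0, mulr0n).
rewrite mulrS addrA => bE tP tQ fP fQ.
have cb : a <= a + h <= b by rewrite bE !lerDl h0 mulrn_wge0.
have [P1 [P2 [tP1 tP2 fP1 fP2 eP]]] := chain_split tP fP cb d0.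
have [Q1 [Q2 [tQ1 tQ2 fQ1 fQ2 eQ]]] := chain_split tQ fQ cb d0.
(* The first block is taken from [P] with probability [l] and from [Q] otherwise; [g] is the
   mean. *)
pose v (i : bool) := chain_sum f (if i then P1 else Q1).
pose g := l *: v true + (1 - l) *: v false.
have [||||i _] := @balance R T bool (fun i => if i then l else 1 - l) v g w
    (h ^+ 2 *+ #|T|) _ _ _ _.
- by case=> //; rewrite subr_ge0.
- by rewrite big_bool/= addrC subrK.
- by rewrite big_bool.
- move=> i _; apply: sqnorm_le => j.
  have /andP[p0 p1] := chain_sum_coord j tP1.
  have /andP[q0 q1] := chain_sum_coord j tQ1.
  rewrite addrAC subrr add0r in p1 q1.
  (* The coefficient is at most 1 in absolute value and both masses lie between 0 and [h]. *)
  have -> : (v i - g) j = (if i then 1 - l else - l) *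
     (chain_sum f P1 j - chain_sum f Q1 j).
    by rewrite /g /v !ffunE /GRing.scale/=; case: i; ring.
  rewrite normrM -[leRHS]mul1r ler_pM//.
    by case: i; rewrite ?normrN ger0_norm//; lra.
  by rewrite ler_norml; apply/andP; split; lra.
move=> wi.
have [s2 [e2 [ts2 fs2 he2 hs2]]] := ih _ _ _ (w + (v i - g)) bE tP2 tQ2 fP2 fQ2.
(* The cuts of [P] and [Q] add a convex combination of two errors bounded by [d]. *)
pose e := e2 + (l *: (chain_sum f P - chain_sum f P1 - chain_sum f P2) +
  (1 - l) *: (chain_sum f Q - chain_sum f Q1 - chain_sum f Q2)).
exists ((if i then P1 else Q1) ++ s2), e; split.
- by apply: tagged_chain_cat ts2; case: ifP.
- by rewrite /finer all_cat; apply/andP; split=> //; case: ifP.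
- move=> j; rewrite /e ffunE mulrS addrC.
  apply: (le_trans (ler_normD _ _)); apply: lerD => //.
  have := eP j; have := eQ j; rewrite !ffunE.
  set x := (X in `|X| <= _ -> _); set y := (X in _ -> `|X| <= _ -> _) => xd yd.
  apply: (le_trans (ler_normD _ _)).
  rewrite !normrM (ger0_norm l0) (@ger0_norm _ (1 - l)) ?subr_ge0//.
  have : l * `|y| <= l * d by rewrite ler_wpM2l.
  have : (1 - l) * `|x| <= (1 - l) * d by rewrite ler_wpM2l// subr_ge0.
  lra.
- rewrite mulrS [leRHS]addrA; apply: le_trans (lerD wi (lexx _)).
  apply: le_trans hs2; rewrite le_eqVlt; apply/orP; left; apply/eqP.
  congr sqnorm; apply/ffunP => j.
  rewrite chain_sum_cat /e /g /v !ffunE /GRing.scale/=.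
  by case: i {wi}; ring.
Qed.

End Coordinates.

(* Used with [g t] in the convex hull of [G t]: Minkowski sums of many small
   sets are almost convex. *)
Lemma minkowski_sum_balance {T : finType} (G : R -> set {ffun T -> R})
    (g : R -> {ffun T -> R}) (D d a b : R) s (w : {ffun T -> R}) :
  (forall t r w', 0 <= r -> exists2 v, G t v &
     sqnorm (w' + r *: (v - g t)) <= sqnorm w' + r ^+ 2 * D) ->
  0 <= D -> tagged_chain a b s -> finer d s ->
  exists2 m, minkowski_sum G s m &
    sqnorm (w + (m - chain_sum g s)) <= sqnorm w + d * (b - a) * D.
Proof.
move=> bal D0; elim: s a w => [|u s ih] a w /=.
  move=> -> _; exists 0; first exact/minkowski_sum_nil.
  by rewrite chain_sum_nil !subrr addr0 mulr0 mul0r addr0.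
move=> [u0 _ us] /andP[ud sd].
have [v Gv vw] := bal u.2 u.1 w (ltW u0).
have [m Gm mw] := ih _ (w + u.1 *: (v - g u.2)) us sd.
exists (u.1 *: v + m); first by apply/minkowski_sum_cons; exists v, m.
rewrite chain_sum_cons.
have -> : w + (u.1 *: v + m - (u.1 *: g u.2 + chain_sum g s)) =
    w + u.1 *: (v - g u.2) + (m - chain_sum g s).
  by rewrite -[RHS]addrA scalerBr opprD [in LHS]addrACA.
apply: (le_trans mw); apply: le_trans (lerD vw (lexx _)) _.
rewrite -addrA lerD2l -mulrDl ler_wpM2r//.
(* Summed over the chain, the squared lengths total at most [d * (b - a)]. *)
have : u.1 * u.1 <= d * u.1 by rewrite ler_wpM2r// ltW.
by rewrite expr2; lra.
Qed.

End Chains.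

(** * Minkowski sums of label choices, determined by label masses up to a small error *)

Section Labels.
Context {R : realType} {J I : finType} (kappa : R -> J) (C : J -> {set I}).
Hypothesis C0 : forall j, C j != finset.set0.

(** Coordinates are pairs of a label and a net point, so that row sums recover the label masses. *)
Definition label_unit (j : J) (i : I) : {ffun J * I -> R} :=
  [ffun x => (x == (j, i))%:R].

Definition label_choices (t : R) : set {ffun J * I -> R} :=
  [set label_unit (kappa t) i | i in [set i | i \in C (kappa t)]].

Definition label_mass : R -> {ffun J -> R} := fun t => [ffun j => (kappa t == j)%:R].

(** For stochastic [q], the mean of a random element of [label_choices t] drawn with law
    [q (kappa t)]. *)
Definition label_avg (q : J -> I -> R) : R -> {ffun J * I -> R} :=
  fun t => [ffun x => (kappa t == x.1)%:R * q x.1 x.2].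

Definition stochastic (q : J -> I -> R) :=
  forall j, [/\ forall i, 0 <= q j i, \sum_i q j i = 1 &
    forall i, 0 < q j i -> i \in C j].

Lemma stochastic_le1 q j i : stochastic q -> q j i <= 1.
Proof.
by case/(_ j) => q0 <- _; rewrite (bigD1 i)//= lerDl sumr_ge0.
Qed.

Lemma label_mass01 t j : 0 <= label_mass t j <= 1.
Proof. by rewrite ffunE; case: eqP => _ /=; rewrite ?ler01 lexx. Qed.

Lemma chain_sum_label_avg q s x :
  chain_sum (label_avg q) s x = chain_sum label_mass s x.1 * q x.1 x.2.
Proof.
rewrite /chain_sum !sum_ffunE mulr_suml; apply: eq_bigr => u _.
by rewrite !ffunE /GRing.scale/= mulrA.
Qed.

(** Drawing a net point with law [q (kappa t)] on each segment gives the prescribed splitting on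
    average. A segment of length [r] has squared deviation at most [r ^+ 2] times the number of
    coordinates, so [minkowski_sum_balance] applies. *)
Lemma label_selection q (e d a b : R) s :
  stochastic q -> 0 <= e -> tagged_chain a b s -> finer d s ->
  d * (b - a) *+ #|{: J * I}| <= e ^+ 2 ->
  exists2 m, minkowski_sum label_choices s m &
    forall x, `|m x - chain_sum label_mass s x.1 * q x.1 x.2| <= e.
Proof.
move=> qst e0 us sd de.
have [||m Gm] := @minkowski_sum_balance R _ label_choices (label_avg q)
    (#|{: J * I}|%:R) d a b s 0 _ _ us sd => //.
  move=> t r w r0; have [q0 q1 qC] := qst (kappa t).
  have [||||i /qC iC hi] := @balance R _ I (q (kappa t))
    (fun i => r *: label_unit (kappa t) i) (r *: label_avg q t) w
    (r ^+ 2 * #|{: J * I}|%:R) => //.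
  - apply/ffunP => -[j i]; rewrite sum_ffunE !ffunE/= (bigD1 i)//= big1 => [|k ki].
      rewrite addr0 !ffunE xpair_eqE eqxx andbT eq_sym /GRing.scale/=.
      by case: eqP => [->|_] /=; ring.
    rewrite !ffunE xpair_eqE (eq_sym i) (negbTE ki) andbF.
    by rewrite /GRing.scale/= !mulr0.
  - move=> i _; rewrite mulr_natr; apply: sqnorm_le => -[j k].
    rewrite !ffunE /GRing.scale/= -mulrBr normrM (ger0_norm r0).
    rewrite ler_piMr// xpair_eqE.
    have /andP[l0 l1] : 0 <= q j k <= 1.
      by have [-> _ _] := qst j; rewrite stochastic_le1.
    rewrite (eq_sym j); case: eqP => _; case: eqP => _ /=;
      rewrite ler_norml; apply/andP; split; lra.
  exists (label_unit (kappa t) i); first by exists i.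
  by rewrite scalerBr.
rewrite add0r sqnorm0 add0r mulr_natr => h; exists m => // x.
rewrite -chain_sum_label_avg.
have := sqnorm_coord e0 (le_trans h de) x.
by rewrite !ffunE.
Qed.

(** A segment of label [j] puts its whole length on a single entry of row [j], in a column of
    [C j]. *)
Lemma label_sum_row a b s m : tagged_chain a b s ->
  minkowski_sum label_choices s m ->
  [/\ forall x, 0 <= m x, forall x, 0 < m x -> x.2 \in C x.1 &
    forall j, \sum_i m (j, i) = chain_sum label_mass s j].
Proof.
elim: s a m => [a m _ /minkowski_sum_nil ->|u s ih a m /= [u0 _ us]].
  split=> [x|x|j]; rewrite ?ffunE ?ltxx// chain_sum_nil ffunE.
  by rewrite big1// => i _; rewrite ffunE.
move=> /minkowski_sum_cons[_ [m' [[i iC <-] Gm' ->]]].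
have [h1 h2 h3] := ih _ _ us Gm'; split=> [x|x|j].
- by rewrite !ffunE addr_ge0// mulr_ge0 ?ler0n// ltW.
- rewrite !ffunE; case: eqP => [-> _|_]; first exact: iC.
  by rewrite scaler0 add0r; exact: h2.
- rewrite chain_sum_cons !ffunE -h3.
  under eq_bigr do rewrite !ffunE.
  rewrite big_split/=; congr (_ + _).
  rewrite -scaler_sumr; congr (_ *: _).
  under eq_bigr do rewrite xpair_eqE.
  rewrite (bigD1 i)//= big1 ?eqxx ?andbT ?addr0 1?eq_sym// => k /negbTE ->.
  by rewrite andbF.
Qed.

(** Each row is divided by its sum; a zero row is replaced by a point mass at some element of [C j],
    which exists by [C0]. *)
Lemma row_stochastic (m : {ffun J * I -> R}) :
  (forall x, 0 <= m x) -> (forall x, 0 < m x -> x.2 \in C x.1) ->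
  exists2 q, stochastic q & forall x, m x = (\sum_i m (x.1, i)) * q x.1 x.2.
Proof.
move=> m0 mC; pose r j := \sum_i m (j, i).
have r0 j : 0 <= r j by exact: sumr_ge0.
have /choice[c cC] : forall j, exists i, i \in C j by move=> j; exact/finset.set0Pn.
exists (fun j i => if r j == 0 then (i == c j)%:R else m (j, i) / r j).
  move=> j; case: eqVneq => rj; split=> [i||i].
  - by rewrite ler0n.
  - by rewrite (bigD1 (c j))//= eqxx big1 ?addr0// => i /negbTE ->.
  - by case: eqP => [->//|_]; rewrite ltxx.
  - by rewrite divr_ge0.
  - by rewrite -mulr_suml divff.
  - have rj0 : 0 < r j by rewrite lt_def rj r0.
    by rewrite pmulr_lgt0 ?invr_gt0// => /mC.
move=> [j i] /=; rewrite -/(r j); case: eqVneq => rj.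
  rewrite rj mul0r; move/eqP: (rj); rewrite psumr_eq0// => /allP/(_ i).
  by rewrite mem_index_enum => /(_ isT)/eqP.
by rewrite mulrC divfK.
Qed.

(** [chain_mix] provides [s] with nearly the combined label masses. In one direction the splitting
    read off a sum over [s] is reproduced on [P] and [Q]; in the other, the splitting of the
    combination is reproduced on [s]. *)
Lemma label_mix (l e : R) : 0 <= l <= 1 -> 0 < e ->
  \forall d \near 0^'+, forall P Q, tagged_chain 0 1 P -> tagged_chain 0 1 Q ->
    finer d P -> finer d Q ->
  exists s, [/\ tagged_chain 0 1 s, finer d s,
    forall m, minkowski_sum label_choices s m ->
      exists mP mQ, [/\ minkowski_sum label_choices P mP,
        minkowski_sum label_choices Q mQ &
        forall x, `|m x - (l *: mP + (1 - l) *: mQ) x| <= e] &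
    forall mP mQ, minkowski_sum label_choices P mP ->
      minkowski_sum label_choices Q mQ ->
      exists2 m, minkowski_sum label_choices s m &
        forall x, `|m x - (l *: mP + (1 - l) *: mQ) x| <= e].
Proof.
move=> l01 e0; have /andP[l0 l1] := l01.
(* With [k.+1] blocks the squared error of [chain_mix] is at most [#|J|%:R / k.+1%:R]. Their number
   is fixed before [d], so that the cut errors [d *+ k.+1] can be made small. *)
pose k := Num.truncn (#|J|%:R / (e / 4) ^+ 2).
have e4 : 0 < e / 4 by rewrite divr_gt0.
have kP : #|J|%:R / k.+1%:R <= (e / 4) ^+ 2 :> R.
  rewrite ler_pdivrMr ?ltr0Sn// mulrC -ler_pdivrMr ?exprn_gt0// ltW//.
  exact: truncnS_gt.
(* For [d <= c], [label_selection] applies on the unit interval with error [e / 2]. *)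
have [c c0 cT] : exists2 c, 0 < c & c * #|{: J * I}|%:R <= (e / 2) ^+ 2.
  have e2 : 0 < (e / 2) ^+ 2 by rewrite exprn_gt0// divr_gt0.
  exists ((e / 2) ^+ 2 / #|{: J * I}|.+1%:R); first by rewrite divr_gt0.
  by rewrite mulrAC ler_pdivrMr ?ltr0Sn// ler_wpM2l ?ler_nat// ltW.
near=> d => P Q tP tQ fP fQ.
have d0 : 0 < d by near: d; exact: nbhs_right_gt.
have dk : d *+ k.+1 <= e / 4.
  rewrite -[d *+ _]mulr_natr -ler_pdivlMr ?ltr0Sn//.
  by near: d; apply: nbhs_right_le; rewrite divr_gt0.
have dT : d * (1 - 0) *+ #|{: J * I}| <= (e / 2) ^+ 2.
  rewrite subr0 mulr1 -mulr_natr.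
  apply: le_trans cT; rewrite ler_wpM2r//.
  by near: d; exact: nbhs_right_le.
have e2 : 0 <= e / 2 by rewrite divr_ge0 ?ltW.
pose mu := chain_sum label_mass.
have [||s [z [ts fs hz hs]]] := @chain_mix R J label_mass label_mass01 l d
    (k.+1%:R^-1) k.+1 0 1 P Q 0 l01 (ltW d0) _ _ tP tQ fP fQ.
- by rewrite invr_ge0.
- by rewrite add0r -[_ *+ _]mulr_natr mulVf.
(* One [e / 4] bounds the accumulated error, the other removes the cut errors [z]. *)
have muP j : `|mu s j - (l * mu P j + (1 - l) * mu Q j)| <= e / 2.
  have h : sqnorm (0 + (mu s - (l *: mu P + (1 - l) *: mu Q)) + z) <= (e / 4) ^+ 2.
    apply: (le_trans hs); rewrite sqnorm0 add0r; apply: le_trans kP.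
    rewrite -[X in X <= _]mulr_natr -[_ *+ #|J|]mulr_natr.
    by rewrite le_eqVlt; apply/orP; left; apply/eqP; field; rewrite nat1r pnatr_eq0.
  have := sqnorm_coord (ltW e4) h j; rewrite add0r !ffunE /GRing.scale/= => yz.
  rewrite -[X in `|X|](addrK (z j)).
  apply: (le_trans (ler_normB _ _)).
  have -> : e / 2 = e / 4 + e / 4 by field.
  by rewrite lerD// (le_trans (hz j)).
have close (q : J -> I -> R) (x : J * I) (m mP mQ : R) : stochastic q ->
    `|m - mu s x.1 * q x.1 x.2| <= e / 2 ->
    l * mP + (1 - l) * mQ = (l * mu P x.1 + (1 - l) * mu Q x.1) * q x.1 x.2 ->
    `|m - (l * mP + (1 - l) * mQ)| <= e.
  move=> qst mq ->.
  rewrite (_ : m - _ = (m - mu s x.1 * q x.1 x.2) +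
    (mu s x.1 - (l * mu P x.1 + (1 - l) * mu Q x.1)) * q x.1 x.2); last by ring.
  apply: (le_trans (ler_normD _ _)); rewrite [leRHS]splitr lerD//.
  have [q0 _ _] := qst x.1.
  rewrite normrM (ger0_norm (q0 _)).
  apply: le_trans (muP x.1); rewrite ler_piMr//; exact: stochastic_le1.
exists s; split=> //.
  move=> m Gm; have [m0 mC mr] := label_sum_row ts Gm.
  have [q qst mq] := row_stochastic m0 mC.
  have [mP GP hP] := label_selection qst e2 tP fP dT.
  have [mQ GQ hQ] := label_selection qst e2 tQ fQ dT.
  exists mP, mQ; split=> // x; rewrite !ffunE /GRing.scale/=.
  rewrite mq mr -/mu.
  (* Since [q] splits [m] exactly, the error comes from the masses and from the selections on [P]
     and [Q]. *)
  rewrite (_ : _ - _ = (mu s x.1 - (l * mu P x.1 + (1 - l) * mu Q x.1)) * q x.1 x.2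
    - (l * (mP x - mu P x.1 * q x.1 x.2) +
       (1 - l) * (mQ x - mu Q x.1 * q x.1 x.2))); last by ring.
  apply: (le_trans (ler_normB _ _)); rewrite [leRHS]splitr lerD//.
    have [q0 _ _] := qst x.1.
    rewrite normrM (ger0_norm (q0 _)).
    by apply: le_trans (muP x.1); rewrite ler_piMr//; exact: stochastic_le1.
  apply: (le_trans (ler_normD _ _)); rewrite !normrM (ger0_norm l0).
  rewrite (@ger0_norm _ (1 - l)) ?subr_ge0//.
  have : l * `|mP x - mu P x.1 * q x.1 x.2| <= l * (e / 2) by rewrite ler_wpM2l.
  have : (1 - l) * `|mQ x - mu Q x.1 * q x.1 x.2| <= (1 - l) * (e / 2).
    by rewrite ler_wpM2l// subr_ge0.
  by lra.
move=> mP mQ GP GQ.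
have [P0 PC Pr] := label_sum_row tP GP; have [Q0 QC Qr] := label_sum_row tQ GQ.
pose m := l *: mP + (1 - l) *: mQ.
have [||q qst mq] := @row_stochastic m.
- by move=> x; rewrite !ffunE addr_ge0// mulr_ge0// subr_ge0.
- move=> x; apply: contraTT => xC; rewrite -leNgt !ffunE.
  have -> : mP x = 0.
    by apply/eqP; rewrite eq_le P0 andbT leNgt; apply: contra xC; exact: PC.
  have -> : mQ x = 0.
    by apply/eqP; rewrite eq_le Q0 andbT leNgt; apply: contra xC; exact: QC.
  by rewrite !scaler0 addr0.
have [ms Gs hs'] := label_selection qst e2 ts fs dT.
exists ms => // x.
rewrite !ffunE; apply: (close q x) => //.
transitivity (m x); first by rewrite !ffunE.
rewrite mq; congr (_ * _).
rewrite -Pr -Qr !mulr_sumr -big_split/=; apply: eq_bigr => i _.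
by rewrite !ffunE.
Unshelve. all: by end_near. Qed.

End Labels.

(** * Compactness in finite dimension *)

Section FiniteDimension.
Context {R : realType} {X : normedModType R}.

(* A linear isomorphism from [R^n] is continuous, hence its norm has a positive
   minimum on the unit sphere of [R^n]. *)
Lemma finite_dimensional_compact_ball (r : R) : finite_dimensional X ->
  compact [set x : X | `|x| <= r].
Proof.
move=> [n [[f lf bf]]]; have [g gK fK] := bf.
have linf u v : f (u + v) = f u + f v.
  by have := lf 1 u v; rewrite !scale1r.
have linfZ a u : f (a *: u) = a *: f u.
  have f0 : f 0 = 0 by apply: (@addrI _ (f 0)); rewrite -linf !addr0.
  by have := lf a u 0; rewrite f0 !addr0.
have gD u v : g (u + v) = g u + g v by rewrite -{1}[u]fK -{1}[v]fK -linf gK.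
have gZ a u : g (a *: u) = a *: g u by rewrite -{1}[u]fK -linfZ gK.
have g0 : g 0 = 0 by rewrite -(scale0r 0) gZ scale0r.
have gE v : g v = \sum_i v 0 i *: g (delta_mx 0 i).
  rewrite {1}[v]row_sum_delta (big_morph g gD g0).
  by apply: eq_bigr => i _; rewrite gZ.
have gcont : continuous g.
  have -> : g = fun v => \sum_i v 0 i *: g (delta_mx 0 i) by apply/funext.
  apply: continuous_big => [|i _ v]; first exact: add_continuous.
  apply: cvgZr_tmp; first exact: nbhs_filter.
  exact: (@coord_continuous R 1 n 0 i v).
have [c c0 gc] : exists2 c, 0 < c & forall v, c * `|v| <= `|g v|.
  pose S := [set v : 'rV[R]_n | `|v| = 1].
  (* The sphere is empty when [n = 0]; then every vector is zero. *)
  have [[v0 Sv0]|noS] := pselect (S !=set0); last first.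
    exists 1 => // v; have [->|v0] := eqVneq v 0; first by rewrite normr0 mulr0.
    case: noS; exists (`|v|^-1 *: v); rewrite /S/= normrZ normfV normr_id.
    by rewrite mulVf// normr_eq0.
  have cS : compact S.
    apply: bounded_closed_compact.
      by exists 1; split=> [|M M1 v /= ->]; rewrite ?num_real// ltW.
    rewrite (_ : S = Num.norm @^-1` [set 1])//; apply: preimage_closed => //.
      by move=> v _; exact: norm_continuous.
  have [|v Sv vmin] := @compact_EVT_min _ _ (fun v => `|g v|) _ (ex_intro _ v0 Sv0) cS.
    apply: continuous_subspaceT => v.
    by apply: continuous_comp; [exact: gcont|exact: norm_continuous].
  exists `|g v|.
    rewrite normr_gt0; apply/eqP => gv0; move: Sv; rewrite inE /S/= => v1.
    have : v = 0 by rewrite -[v]fK gv0 -g0 fK.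
    by move=> /eqP; rewrite -normr_eq0 v1 oner_eq0.
  move=> u; have [->|u0] := eqVneq u 0; first by rewrite normr0 mulr0.
  have := vmin (`|u|^-1 *: u); rewrite inE /S/= normrZ normfV normr_id.
  rewrite mulVf ?normr_eq0// => /(_ erefl).
  by rewrite gZ normrZ normfV normr_id ler_pdivlMl ?normr_gt0// mulrC.
(* The set on the right is closed and, by the lower bound [gc], bounded by [r / c]. *)
have -> : [set x : X | `|x| <= r] = g @` [set v | `|g v| <= r].
  by apply/seteqP; split=> [x /= xr|_ [v /= vr <-]//]; exists (f x); rewrite ?gK.
apply: continuous_compact; first exact: continuous_subspaceT.
apply: bounded_closed_compact.
  exists (r / c); split=> [|M rM v /= vr]; first exact: num_real.
  by rewrite (le_trans _ (ltW rM))// ler_pdivlMr// mulrC (le_trans (gc v)).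
rewrite (_ : [set _ | _] = (fun v => `|g v|) @^-1` [set x | x <= r])//.
apply: preimage_closed; last exact: closed_le.
move=> v _; apply: continuous_comp; [exact: gcont|exact: norm_continuous].
Qed.

Lemma compact_finite_net (K : set X) (e : R) : compact K -> 0 < e ->
  exists n (p : 'I_n.+1 -> X), forall x, K x -> exists i, `|x - p i| <= e.
Proof.
rewrite compact_cover => cK e0.
have [|x Kx|D _ KD] := cK X K (fun x => ball x e).
- by move=> x _; exact: ball_open.
- by exists x => //; exact: ballxx.
(* The leading [0] keeps the net non-empty even if [D] is empty. *)
pose s := 0 :: finmap.enum_fset D.
exists (size (finmap.enum_fset D)), (fun i => nth 0 s i) => x /KD[y yD yx].
have ys : y \in s by rewrite inE; apply/orP; right.
have ilt : (index y s < (size (finmap.enum_fset D)).+1)%N by move: ys; rewrite -index_mem.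
exists (Ordinal ilt) => /=; rewrite nth_index// distrC ltW//.
by move: yx; rewrite -ball_normE.
Qed.

(** Gives closedness of the combination, which can fail for sums of sets that are merely closed. *)
Lemma compact_set_comb (A B : set X) (l m : R) : compact A -> compact B ->
  compact (set_add (set_scale l A) (set_scale m B)).
Proof.
move=> cA cB.
have -> : set_add (set_scale l A) (set_scale m B) =
    (fun z : X * X => l *: z.1 + m *: z.2) @` (A `*` B).
  apply/seteqP; split=> [_ [_ [a Aa <-] [_ [b Bb <-] <-]]|_ [[a b] [/= Aa Bb] <-]].
    by exists (a, b).
  by exists (l *: a); [exists a|exists (m *: b) => //; exists b].
apply: continuous_compact; last exact: compact_setX.
apply: continuous_subspaceT => z; apply: cvgD; apply: cvgZl_tmp.
  exact: cvg_fst.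
exact: cvg_snd.
Qed.

End FiniteDimension.

Lemma conv_dist_le (R : realType) (X : normedModType R) (l e : R)
    (x y x' y' : X) : 0 <= l <= 1 -> `|x - x'| <= e -> `|y - y'| <= e ->
  `|(l *: x + (1 - l) *: y) - (l *: x' + (1 - l) *: y')| <= e.
Proof.
move=> /andP[l0 l1] xx yy; rewrite opprD addrACA -!scalerBr.
apply: (le_trans (ler_normD _ _)); rewrite !normrZ (ger0_norm l0).
rewrite (@ger0_norm _ (1 - l)) ?subr_ge0//.
have : l * `|x - x'| <= l * e by rewrite ler_wpM2l.
have : (1 - l) * `|y - y'| <= (1 - l) * e by rewrite ler_wpM2l// subr_ge0.
by lra.
Qed.

(** * Hausdorff distance in terms of nearby points *)

Section Hausdorff.
Context {R : realType} {X : normedModType R}.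
Implicit Types (A B C : set X) (e : R).

Definition set_near e A B := forall a, A a -> exists2 b, B b & `|a - b| <= e.

(** The strict inequality yields an actual point within [e], although the infimum may not be
    attained. *)
Lemma hausdorff_dist_near e A B : (hausdorff_dist A B < e%:E)%E ->
  set_near e A B /\ set_near e B A.
Proof.
have key C D : (ereal_sup [set edist_inf D a | a in C] < e%:E)%E -> set_near e C D.
  move=> h a Ca.
  have : (edist_inf D a < e%:E)%E.
    by apply: le_lt_trans h; apply: ereal_sup_ubound; exists a.
  move=> /ereal_inf_lt[_ [b Db <-]]; rewrite edist_norm lte_fin => ab.
  by exists b => //; exact: ltW.
by rewrite /hausdorff_dist gt_max => /andP[/key ? /key].
Qed.

Lemma near_hausdorff_dist e A B : set_near e A B -> set_near e B A ->
  (hausdorff_dist A B <= e%:E)%E.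
Proof.
have key C D : set_near e C D ->
    (ereal_sup [set edist_inf D a | a in C] <= e%:E)%E.
  move=> h; apply: ge_ereal_sup => _ [a Ca <-].
  have [b Db ab] := h _ Ca.
  apply: (@le_trans _ _ (edist (a, b))); first by apply: ereal_inf_lbound; exists b.
  by rewrite edist_norm lee_fin.
by move=> /key AB /key BA; rewrite /hausdorff_dist ge_max AB.
Qed.

End Hausdorff.

(** * Partitions versus chains, and comparison of Minkowski sums *)

Section Conversions.
Context {R : realType}.

Lemma tagged_chain_mkseq (a b : R) (xs : seq R) (tg : nat -> R) :
  path <%R a xs -> last a xs = b ->
  (forall i, (i < size xs)%N ->
    nth 0 (a :: xs) i <= tg i <= nth 0 (a :: xs) i.+1) ->
  tagged_chain a b
    [seq (nth 0 (a :: xs) i.+1 - nth 0 (a :: xs) i, tg i) | i <- iota 0 (size xs)].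
Proof.
elim: xs a tg => [//|x xs ih] a tg /= /andP[ax xxs] xb tgP; split.
- by rewrite subr_gt0.
- by rewrite subrKC; exact: (tgP 0%N).
- rewrite subrKC (iotaDl 1 0) -map_comp.
  exact: (ih x (fun i => tg i.+1) xxs xb (fun i => tgP i.+1)).
Qed.

Lemma chain_of_partition (P : tagged_partition R) : exists s,
  [/\ tagged_chain 0 1 s, finer (mesh P) s &
    forall (X : lmodType R) (F : R -> set X), riemann_sum F P = minkowski_sum F s].
Proof.
pose n := size (division P).
(* Tags are extended by [0] to all naturals, so that the induction in [tagged_chain_mkseq] can shift
   them. *)
pose tg i := if insub i is Some j then @Defs.tag R P j else 0.
have tgE (i : 'I_n) : tg i = Defs.tag i by rewrite /tg valK.
pose s := [seq (nth 0 (0 :: division P) i.+1 - nth 0 (0 :: division P) i, tg i)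
  | i <- iota 0 n].
have sE : s = [seq (seglen i, Defs.tag i) | i <- enum 'I_n].
  rewrite /s -val_enum_ord -map_comp; apply: eq_map => i /=.
  by rewrite tgE.
exists s; split.
- have [h1 /eqP h2] := divisionP P; apply: tagged_chain_mkseq => // i iP.
  have := Defs.tagP (Ordinal iP); rewrite in_itv/=.
  by have := tgE (Ordinal iP) => /= ->.
- apply/allP => u; rewrite sE => /mapP[i _ ->] /=.
  exact: le_bigmax.
- move=> X F; rewrite /minkowski_sum big_map -[n]subn0 -/(index_iota 0 n) big_mkord.
  by apply: eq_bigr => i _; rewrite tgE.
Qed.

Lemma partition_of_chain (s : seq (R * R)) (d : R) : tagged_chain 0 1 s ->
  0 <= d -> finer d s -> exists2 P : tagged_partition R, mesh P <= d &
    forall (X : lmodType R) (F : R -> set X), riemann_sum F P = minkowski_sum F s.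
Proof.
(* [scanl] omits the initial point, as [division] does. *)
pose pts a (s : seq (R * R)) : seq R := scanl (fun x u => x + u.1) a s.
have size_pts a s' : size (pts a s') = size s' by rewrite size_scanl.
have itvP a b s' : tagged_chain a b s' -> itv_partition a b (pts a s').
  rewrite /itv_partition; elim: s' a => [a /= ->//|u s' ih a /= [u0 _ /ih[h1 h2]]].
  by rewrite h1 h2 ltrDl u0.
have tagP' a b s' i : tagged_chain a b s' -> (i < size s')%N ->
    [/\ nth 0 (a :: pts a s') i <= (nth 0 s' i).2 <= nth 0 (a :: pts a s') i.+1 &
    nth 0 (a :: pts a s') i.+1 - nth 0 (a :: pts a s') i = (nth 0 s' i).1].
  elim: s' a i => [//|u s' ih] a [|i] /= [u0 ua us] => [_|]; last exact: ih.
  by rewrite addrAC subrr add0r.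
move=> sP d0 sd.
have tgP (i : 'I_(size (pts 0 s))) : (nth 0 s i).2 \in
    `[nth 0 (0 :: pts 0 s) i, nth 0 (0 :: pts 0 s) i.+1].
  have := ltn_ord i; rewrite [X in (_ < X)%N]size_pts => /(tagP' _ _ _ _ sP)[h _].
  by rewrite in_itv.
exists (TaggedPartition (itvP _ _ _ sP) tgP).
  apply: bigmax_le => // i _; rewrite /seglen/=.
  have := ltn_ord i; rewrite [X in (_ < X)%N]size_pts => il.
  have [_ ->] := tagP' _ _ _ _ sP il.
  by move/allP: sd => /(_ (nth 0 s i)); apply; rewrite mem_nth.
move=> X F; rewrite /riemann_sum/= /minkowski_sum (big_nth 0) -[in RHS](size_pts 0).
rewrite big_mkord; apply: eq_bigr => i _; rewrite /seglen/=.
have := ltn_ord i; rewrite [X in (_ < X)%N]size_pts => il.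
by have [_ ->] := tagP' _ _ _ _ sP il.
Qed.

(** Errors add up with weights of total [b - a]. The maps [phi] and [psi] allow comparing sums in
    [X] with sums of encoded label choices. *)
Lemma minkowski_sum_transfer (U V : lmodType R) (Y : normedModType R)
    (phi : {linear U -> Y}) (psi : {linear V -> Y})
    (F : R -> set U) (G : R -> set V) (e a b : R) s u :
  (forall t x, a <= t <= b -> F t x ->
    exists2 y, G t y & `|phi x - psi y| <= e) ->
  tagged_chain a b s -> minkowski_sum F s u ->
  exists2 v, minkowski_sum G s v & `|phi u - psi v| <= (b - a) * e.
Proof.
elim: s a u => [a u _ -> /minkowski_sum_nil ->|t s ih a u FG /= [t0 /andP[at1 at2] ts]].
  exists 0; first exact/minkowski_sum_nil.
  by rewrite !linear0 addr0 normr0 subrr mul0r.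
have tb := tagged_chain_le ts.
move=> /minkowski_sum_cons[x [y [Fx Fy ->]]].
have [|x' Gx' xx'] := FG t.2 x _ Fx; first by rewrite at1 (le_trans at2).
have [|y' Gy' yy'] := ih _ y _ ts Fy.
  move=> r z /andP[r1 r2]; apply: FG; rewrite r2 andbT (le_trans _ r1)//.
  by rewrite lerDl ltW.
exists (t.1 *: x' + y'); first by apply/minkowski_sum_cons; exists x', y'.
rewrite [phi _]linearD [psi _]linearD [phi (_ *: _)]linearZ [psi (_ *: _)]linearZ/=.
rewrite opprD addrACA -scalerBr.
apply: (le_trans (ler_normD _ _)); rewrite normrZ gtr0_norm//.
have : t.1 * `|phi x - psi x'| <= t.1 * e by rewrite ler_wpM2l// ltW.
by lra.
Qed.

End Conversions.

(** * From label choices back to [F] *)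

Section Mixing.
Context {R : realType} {X : normedModType R} (F : R -> set X).

Section Readout.
Context {J I : finType} (p : I -> X).

Definition readout (m : {ffun J * I -> R}) : X := \sum_x m x *: p x.2.

Lemma readout_is_linear : linear readout.
Proof.
move=> a u v; rewrite /readout scaler_sumr -big_split/=.
by apply: eq_bigr => x _; rewrite !ffunE scalerDl scalerA.
Qed.

HB.instance Definition _ := GRing.isLinear.Build R {ffun J * I -> R} X *:%R
  readout readout_is_linear.

Lemma readout_unit (j : J) i : readout (label_unit j i) = p i.
Proof.
rewrite /readout (bigD1 (j, i))//= big1 ?ffunE ?eqxx ?scale1r ?addr0//.
by move=> x /negbTE xji; rewrite ffunE xji scale0r.
Qed.

Lemma readout_lipschitz (u v : {ffun J * I -> R}) (e : R) :
  (forall x, `|u x - v x| <= e) ->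
  `|readout u - readout v| <= e * \sum_(x : J * I) `|p x.2|.
Proof.
move=> uv; rewrite -linearB/= /readout mulr_sumr.
apply: (le_trans (ler_norm_sum _ _ _)); apply: ler_sum => x _.
by rewrite normrZ !ffunE ler_wpM2r.
Qed.

End Readout.

(* Labelling [t] by the set of net points close to [F t] makes [F] uniformly
   close to a multifunction with finitely many finite values, which are encoded
   by the unit vectors [label_unit j i]. *)
Lemma riemann_mix (l e r : R) : 0 <= l <= 1 -> 0 < e ->
  multifunction F -> compact [set x : X | `|x| <= r] ->
  (forall t x, 0 <= t <= 1 -> F t x -> `|x| <= r) ->
  \forall d \near 0^'+, forall P Q, tagged_chain 0 1 P -> tagged_chain 0 1 Q ->
    finer d P -> finer d Q ->
  exists s, [/\ tagged_chain 0 1 s, finer d s &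
    let SPQ := set_add (set_scale l (minkowski_sum F P))
                       (set_scale (1 - l) (minkowski_sum F Q)) in
    set_near e (minkowski_sum F s) SPQ /\ set_near e SPQ (minkowski_sum F s)].
Proof.
move=> l01 e0 F0 cr Fr.
(* Three errors of [e / 3]: from [F] to labels, between label sums, and back to [F]. *)
have e3 : 0 < e / 3 by rewrite divr_gt0.
have [n [p net]] := compact_finite_net cr e3.
set I := 'I_n.+1 in p net.
(* The empty label does not occur on [0, 1]; its value under [C] is junk. *)
pose C (j : {set I}) : {set I} := if j == finset.set0 then finset.setT else j.
have C0 j : C j != finset.set0.
  rewrite /C; case: ifPn => // _; apply/finset.set0Pn.
  by exists ord0; rewrite finset.in_setT.
pose kappa t : {set I} :=
  finset.finset (fun i => `[< exists2 x, F t x & `|x - p i| <= e / 3 >]).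
(* Here the label is non-empty because [F t] is, so [C] leaves it unchanged. *)
have kappaP t i : 0 <= t <= 1 ->
    i \in C (kappa t) <-> exists2 x, F t x & `|x - p i| <= e / 3.
  move=> t01; have [x Fx] := F0 t t01.
  have [i0 xi0] := net x (Fr _ _ t01 Fx).
  have k0 : i0 \in kappa t by rewrite finset.inE; apply/asboolP; exists x.
  rewrite /C ifN; last by apply/finset.set0Pn; exists i0.
  by rewrite finset.inE; split=> /asboolP.
pose G := label_choices kappa C.
pose Phi := @readout {set I} I p.
(* The [+ 1] makes [K] positive, hence a valid divisor. *)
pose K := \sum_(x : {set I} * I) `|p x.2| + 1.
have K0 : 0 < K by rewrite ltr_wpDl// sumr_ge0.
have FG t x : 0 <= t <= 1 -> F t x -> exists2 y, G t y & `|x - Phi y| <= e / 3.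
  move=> t01 Fx; have [i xi] := net x (Fr _ _ t01 Fx).
  exists (label_unit (kappa t) i); last by rewrite /Phi readout_unit.
  by exists i => //=; apply/kappaP => //; exists x.
have GF t y : 0 <= t <= 1 -> G t y -> exists2 x, F t x & `|Phi y - x| <= e / 3.
  move=> t01 [i /= /kappaP -/(_ t01)[x Fx xi] <-]; exists x => //.
  by rewrite /Phi readout_unit distrC.
have toG s u : tagged_chain 0 1 s -> minkowski_sum F s u ->
    exists2 v, minkowski_sum G s v & `|u - Phi v| <= e / 3.
  move=> ts Fu.
  have [v Gv uv] := @minkowski_sum_transfer R X _ X idfun Phi F G _ _ _ _ _ FG ts Fu.
  by exists v => //; rewrite subr0 mul1r in uv.
have toF s v : tagged_chain 0 1 s -> minkowski_sum G s v ->
    exists2 u, minkowski_sum F s u & `|Phi v - u| <= e / 3.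
  move=> ts Gv.
  have [u Fu uv] := @minkowski_sum_transfer R _ X X Phi idfun G F _ _ _ _ _ GF ts Gv.
  by exists u => //; rewrite subr0 mul1r in uv.
have eK : 0 < e / 3 / K by rewrite divr_gt0.
have PhiK (u v : {ffun {set I} * I -> R}) :
    (forall x, `|u x - v x| <= e / 3 / K) -> `|Phi u - Phi v| <= e / 3.
  move=> uv; apply: (le_trans (readout_lipschitz p uv)).
  apply: (@le_trans _ _ (e / 3 / K * K)); last by rewrite divfK// gt_eqF.
  by rewrite ler_wpM2l// ?ltW// ltrDl.
have PhiE u v : Phi (l *: u + (1 - l) *: v) = l *: Phi u + (1 - l) *: Phi v.
  by rewrite /Phi linearD !linearZ.
have tri (a b c d : X) : `|a - b| <= e / 3 -> `|b - c| <= e / 3 ->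
    `|c - d| <= e / 3 -> `|a - d| <= e.
  move=> ab bc cd.
  rewrite (_ : a - d = (a - b) + (b - c) + (c - d)); last by rewrite !addrA !subrK.
  apply: (le_trans (ler_normD _ _)).
  have := ler_normD (a - b) (b - c); lra.
apply: filterS (@label_mix R _ _ kappa C C0 l _ l01 eK) => d mix P Q tP tQ fP fQ.
have [s [ts fs hs1 hs2]] := mix P Q tP tQ fP fQ.
exists s; split=> //; split.
  move=> u Fu; have [m Gm um] := toG _ _ ts Fu.
  have [mP [mQ [GP GQ mPQ]]] := hs1 _ Gm.
  have [x Fx xP] := toF _ _ tP GP; have [y Fy yQ] := toF _ _ tQ GQ.
  exists (l *: x + (1 - l) *: y).
    by exists (l *: x); [exists x|exists ((1 - l) *: y) => //; exists y].
  apply: (tri _ _ _ _ um (PhiK _ _ mPQ)).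
  by rewrite PhiE; exact: conv_dist_le.
move=> _ [_ [x Fx <-] [_ [y Fy <-] <-]].
have [mP GP xP] := toG _ _ tP Fx; have [mQ GQ yQ] := toG _ _ tQ Fy.
have [m Gm mPQ] := hs2 _ _ GP GQ.
have [u Fu mu] := toF _ _ ts Gm.
exists u => //; apply: (tri _ (Phi (l *: mP + (1 - l) *: mQ)) _ _ _ _ mu).
  by rewrite PhiE; exact: conv_dist_le.
by rewrite distrC; exact: PhiK.
Qed.

End Mixing.

(** * Limits of Riemann sums in terms of chains *)

Section Limits.
Context {R : realType} {X : normedModType R} (F : R -> set X).

(** With [chain_riemann_limits], replaces sequences of partitions by single chains of prescribed
    fineness and accuracy. *)
Lemma riemann_limits_chain A (d e : R) : riemann_limits F A -> 0 < d -> 0 < e ->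
  exists s, [/\ tagged_chain 0 1 s, finer d s, set_near e (minkowski_sum F s) A &
    set_near e A (minkowski_sum F s)].
Proof.
move=> [_ _ [P [mP hP]]] d0 e0.
have /fine_cvgP[fin /cvgr0Pnorm_lt/(_ e e0) he] := hP.
have /cvgr0Pnorm_lt/(_ d d0) hd := mP.
have [k [[fk ek] dk]] := filter_ex (filterI (filterI fin he) hd).
have [s [ts fs sE]] := chain_of_partition (P k).
have [|h1 h2] := @hausdorff_dist_near R X e (riemann_sum F (P k)) A.
  by rewrite -(fineK fk) lte_fin (le_lt_trans (ler_norm _)).
exists s; split=> //; rewrite -?sE//.
apply/allP => u /(allP fs)/= us; apply: (le_trans us).
exact: le_trans (ler_norm _) (ltW dk).
Qed.

Lemma chain_riemann_limits A : A !=set0 -> closed A ->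
  (forall d, 0 < d -> exists s, [/\ tagged_chain 0 1 s, finer d s,
    set_near d (minkowski_sum F s) A & set_near d A (minkowski_sum F s)]) ->
  riemann_limits F A.
Proof.
move=> A0 cA h; split=> //.
have /choice[P PP] : forall k : nat, exists P : tagged_partition R,
    mesh P <= harmonic k /\ (hausdorff_dist (riemann_sum F P) A <= (harmonic k : R)%:E)%E.
  move=> k; have [|s [ts fs h1 h2]] := h (harmonic k); first exact: harmonic_gt0.
  have [P mP PE] := partition_of_chain ts (harmonic_ge0 k) fs.
  by exists P; split=> //; rewrite PE; exact: near_hausdorff_dist.
have cst0 : (fun=> 0 : R) @ \oo --> (0 : R) by exact: cvg_cst.
exists P; split.
  apply: (squeeze_cvgr _ cst0 (@cvg_harmonic R)); apply: nearW => k.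
  by rewrite (PP k).1 andbT /mesh; apply: bigmax_ge_id.
apply: (@squeeze_cvge _ _ _ _ (fun=> 0%E) _ (EFin \o harmonic)).
(* Non-negativity uses a point of [A]: a supremum over the empty set is minus infinity. *)
- apply: nearW => k /=; rewrite (PP k).2 andbT.
  rewrite /hausdorff_dist le_max; apply/orP; right.
  have [a Aa] := A0.
  apply: le_ereal_sup_tmp; exists (edist_inf (riemann_sum F (P k)) a); first by exists a.
  exact: edist_inf_ge0.
- exact: cvg_cst.
- exact: cvge_harmonic.
Qed.

End Limits.

Theorem theorem3p7 (R : realType) (X : completeNormedModType R)
    (finX : finite_dimensional X) (F : R -> set X)
    (F_neq0 : multifunction F) (F_bounded : bounded_multifunction F)
    (A B : set X) (AF : riemann_limits F A) (BF : riemann_limits F B)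
    (l : R) (l01 : 0 <= l <= 1) :
  riemann_limits F (set_add (set_scale l A) (set_scale (1 - l) B)).
Proof.
have [r Fr] : exists r : R, forall t x, 0 <= t <= 1 -> F t x -> `|x| <= r.
  have [r Fr] : exists r : R, (multifunction_sup F <= r%:E)%E.
    move: F_bounded; rewrite /bounded_multifunction.
    case: (multifunction_sup F) => [r _|//|_]; first by exists r.
    by exists 0; rewrite leNye.
  exists r => t x t01 Fx.
  rewrite -lee_fin; apply: le_trans Fr; apply: ereal_sup_ubound.
  by exists x => //; exists t.
(* Each point of [C] is within 1 of a Riemann sum, whose points have norm at most [r] since the
   lengths add up to 1. *)
have compactL C : riemann_limits F C -> compact C.
  move=> CF; have [_ cC _] := CF.
  apply: subclosed_compact cC (@finite_dimensional_compact_ball _ _ (r + 1) finX) _.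
  have [s [ts _ _ hs]] := riemann_limits_chain CF ltr01 ltr01.
  move=> c /hs[y Fy cy] /=.
  (* Compare the Riemann sum with that of the zero multifunction. *)
  pose G : R -> set X := fun=> [set 0].
  have [|v Gv yv] := @minkowski_sum_transfer R X X X idfun idfun F G r 0 1 s y _ ts Fy.
    by move=> t x t01 Fx; exists 0; rewrite //= subr0; exact: Fr Fx.
  have v0 : v = 0.
    elim: s {ts hs Fy yv} v Gv => [v /minkowski_sum_nil//|u s ih v].
    move=> /minkowski_sum_cons[x [z [-> /ih -> ->]]].
    by rewrite scaler0 addr0.
  move: yv; rewrite v0 /= !subr0 mul1r => yr.
  rewrite -(subrK y c) (le_trans (ler_normD _ _))// addrC lerD//.
have [[a Aa] _ _] := AF; have [[b Bb] _ _] := BF.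
apply: chain_riemann_limits.
- exists (l *: a + (1 - l) *: b).
  by exists (l *: a); [exists a|exists ((1 - l) *: b) => //; exists b].
- apply: compact_closed; first exact: norm_hausdorff.
  by apply: compact_set_comb; exact: compactL.
(* One [e / 2] is spent on the mixing, the other on replacing the sums over [P] and [Q] by [A] and
   [B]. *)
move=> e e0; have e2 : 0 < e / 2 by rewrite divr_gt0.
have mix := riemann_mix l01 e2 F_neq0 (finite_dimensional_compact_ball finX) Fr.
(* [d <= e] because [chain_riemann_limits] bounds fineness and distance by the same number. *)
have [d [[d0 de] {}mix]] := filter_ex (filterI (filterI
  (nbhs_right_gt 0) (nbhs_right_le e0)) mix).
have [P [tP fP PA AP]] := riemann_limits_chain AF d0 e2.
have [Q [tQ fQ QB BQ]] := riemann_limits_chain BF d0 e2.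
have [s [ts fs [h1 h2]]] := mix P Q tP tQ fP fQ.
exists s; split=> //.
- by apply/allP => u /(allP fs) /= us; exact: le_trans us de.
- move=> z /h1[_ [_ [x Fx <-] [_ [y Fy <-] <-]] zxy].
  have [a' Aa' xa] := PA _ Fx; have [b' Bb' yb] := QB _ Fy.
  exists (l *: a' + (1 - l) *: b').
    by exists (l *: a'); [exists a'|exists ((1 - l) *: b') => //; exists b'].
  rewrite -(subrKA (l *: x + (1 - l) *: y)) [leRHS]splitr.
  by rewrite (le_trans (ler_normD _ _))// lerD// conv_dist_le.
- move=> _ [_ [a' Aa' <-] [_ [b' Bb' <-] <-]].
  have [x Fx xa] := AP _ Aa'; have [y Fy yb] := BQ _ Bb'.
  have [|z Fz zxy] := h2 (l *: x + (1 - l) *: y).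
    by exists (l *: x); [exists x|exists ((1 - l) *: y) => //; exists y].
  exists z => //.
  rewrite -(subrKA (l *: x + (1 - l) *: y)) [leRHS]splitr.
  by rewrite (le_trans (ler_normD _ _))// lerD// conv_dist_le.
Qed.
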